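(* Let $\alpha_0,\alpha_1\in\mathbb{C}$ with $\alpha_0+\alpha_1=0$. The system of partial differential equations in the variables $t_1,t_2,t_3$ $$dq_m=\sum_{i=1}^{3}\frac{\partial K_i}{\partial p_m}\,dt_i,\qquad dp_m=-\sum_{i=1}^{3}\frac{\partial K_i}{\partial q_m}\,dt_i\qquad(m=1,2),$$ with the polynomial Hamiltonians $K_1,K_2,K_3$ given in the context, has $K_1$, $K_2$ and $K_3$ as first integrals; i.e. each $K_j$ is constant along solutions with respect to each of $t_1,t_2,t_3$.
   Context: The Hamiltonians are $$K_1=q_1p_1^2+q_1^2-\alpha_0p_1+\tfrac14q_2^2-\tfrac14p_2^2+p_1q_2p_2,$$ $$K_2=q_2^2p_2^2-\tfrac14q_2^2+\tfrac14p_2^2-2\alpha_0q_2p_2+q_1q_2^2+q_1p_2^2-p_1q_2p_2+p_1^2q_2^2,$$ $$\begin{aligned}K_3=&\tfrac12q_1^2p_1^4+q_1^3p_1^2+\tfrac12q_1^4-\alpha_0q_1p_1^3+\alpha_1q_1^2p_1+\tfrac12\alpha_0^2p_1^2+\tfrac1{32}q_2^4+\tfrac1{32}p_2^4-\tfrac1{16}q_2^2p_2^2+q_1p_1^3q_2p_2\\&+\tfrac12p_1^2q_2^2p_2^2-\tfrac14q_1p_1^2p_2^2-\tfrac14p_1q_2p_2^3+q_1^2p_1q_2p_2+\tfrac14q_1p_1^2q_2^2+\tfrac14p_1q_2^3p_2-\alpha_0p_1^2q_2p_2\\&+\tfrac14\alpha_0p_1p_2^2+\tfrac14\alpha_1p_1q_2^2+\tfrac14q_1^2q_2^2-\tfrac14q_1^2p_2^2.\end{aligned}$$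 *)

(* Defs.v *)
From HB Require Import structures.
From mathcomp Require Import all_boot all_order all_algebra.
From mathcomp Require Import all_classical all_reals all_analysis.

Set Implicit Arguments.
Unset Strict Implicit.
Unset Printing Implicit Defensive.

Import Order.TTheory GRing.Theory Num.Theory.
Import numFieldNormedType.Exports.

Local Open Scope classical_set_scope.
Local Open Scope ring_scope.

(* A phase point is a pair [q p : 'rV_2] with q_1 = q 0 0, q_2 = q 0 1 (likewise
   for p); the multi-time (t_1, t_2, t_3) is a vector in ['rV_3]. The notions are
   set up over an arbitrary [numFieldType] and used at [R[i]], [R : realType]:
   differentials and derivatives are then complex-linear, i.e. solutions are
   holomorphic functions of three complex variables. *)

Definition K1 (C : numFieldType) (alpha0 : C) (q p : 'rV[C]_2) : C :=
  let: q1 := q 0 0 in let: q2 := q 0 1 in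
  let: p1 := p 0 0 in let: p2 := p 0 1 in
  q1 * p1 ^+ 2 + q1 ^+ 2 - alpha0 * p1 + 1 / 4 * q2 ^+ 2 - 1 / 4 * p2 ^+ 2
  + p1 * q2 * p2.

Definition K2 (C : numFieldType) (alpha0 : C) (q p : 'rV[C]_2) : C :=
  let: q1 := q 0 0 in let: q2 := q 0 1 in
  let: p1 := p 0 0 in let: p2 := p 0 1 in
  q2 ^+ 2 * p2 ^+ 2 - 1 / 4 * q2 ^+ 2 + 1 / 4 * p2 ^+ 2
  - 2 * alpha0 * q2 * p2 + q1 * q2 ^+ 2 + q1 * p2 ^+ 2 - p1 * q2 * p2
  + p1 ^+ 2 * q2 ^+ 2.

Definition K3 (C : numFieldType) (alpha0 alpha1 : C) (q p : 'rV[C]_2) :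
    C :=
  let: q1 := q 0 0 in let: q2 := q 0 1 in
  let: p1 := p 0 0 in let: p2 := p 0 1 in
  1 / 2 * q1 ^+ 2 * p1 ^+ 4 + q1 ^+ 3 * p1 ^+ 2 + 1 / 2 * q1 ^+ 4
  - alpha0 * q1 * p1 ^+ 3 + alpha1 * q1 ^+ 2 * p1
  + 1 / 2 * alpha0 ^+ 2 * p1 ^+ 2 + 1 / 32 * q2 ^+ 4 + 1 / 32 * p2 ^+ 4
  - 1 / 16 * q2 ^+ 2 * p2 ^+ 2 + q1 * p1 ^+ 3 * q2 * p2
  + 1 / 2 * p1 ^+ 2 * q2 ^+ 2 * p2 ^+ 2 - 1 / 4 * q1 * p1 ^+ 2 * p2 ^+ 2
  - 1 / 4 * p1 * q2 * p2 ^+ 3 + q1 ^+ 2 * p1 * q2 * p2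
  + 1 / 4 * q1 * p1 ^+ 2 * q2 ^+ 2 + 1 / 4 * p1 * q2 ^+ 3 * p2
  - alpha0 * p1 ^+ 2 * q2 * p2 + 1 / 4 * alpha0 * p1 * p2 ^+ 2
  + 1 / 4 * alpha1 * p1 * q2 ^+ 2 + 1 / 4 * q1 ^+ 2 * q2 ^+ 2
  - 1 / 4 * q1 ^+ 2 * p2 ^+ 2.

(* Indices are shifted by one: [hamiltonian alpha0 alpha1 j] is K_{j+1}. *)
Definition hamiltonian (C : numFieldType) (alpha0 alpha1 : C) (j : 'I_3) :
    'rV[C]_2 -> 'rV[C]_2 -> C :=
  match val j with
  | 0%N => K1 alpha0
  | 1%N => K2 alpha0
  | _ => K3 alpha0 alpha1
  end.

Definition partial_q (C : numFieldType) (F : 'rV[C]_2 -> 'rV[C]_2 -> C)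
    (m : 'I_2) (q p : 'rV[C]_2) : C :=
  'D_(delta_mx 0 m) (fun q' : 'rV[C]_2 => F q' p) q.

Definition partial_p (C : numFieldType) (F : 'rV[C]_2 -> 'rV[C]_2 -> C)
    (m : 'I_2) (q p : 'rV[C]_2) : C :=
  'D_(delta_mx 0 m) (fun p' : 'rV[C]_2 => F q p') p.

(* The Pfaffian system dq_m = sum_i (dH_i/dp_m) dt_i, dp_m = - sum_i
   (dH_i/dq_m) dt_i, read as an equality of complex differentials at every
   point of U; the argument [dt] is the tangent vector on which both sides are
   evaluated. *)
Definition is_solution (C : numFieldType)
    (H : 'I_3 -> 'rV[C]_2 -> 'rV[C]_2 -> C)
    (U : set 'rV[C]_3) (q p : 'rV[C]_3 -> 'rV[C]_2) : Prop :=
  forall t, U t -> forall m : 'I_2,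
    is_diff t (fun s : 'rV[C]_3 => q s 0 m)
      (fun dt : 'rV[C]_3 =>
         \sum_(i < 3) partial_p (H i) m (q t) (p t) * dt 0 i) /\
    is_diff t (fun s : 'rV[C]_3 => p s 0 m)
      (fun dt : 'rV[C]_3 =>
         - \sum_(i < 3) partial_q (H i) m (q t) (p t) * dt 0 i).

(* Vanishing of every partial derivative makes sense on any open domain;
   constancy of the value can only be expected on a connected one. *)
Definition is_first_integral (C : numFieldType)
    (H : 'I_3 -> 'rV[C]_2 -> 'rV[C]_2 -> C)
    (F : 'rV[C]_2 -> 'rV[C]_2 -> C) : Prop :=
  forall (U : set 'rV[C]_3) (q p : 'rV[C]_3 -> 'rV[C]_2),
    open U -> is_solution H U q p ->
    (forall t, U t -> forall i : 'I_3,
       is_derive t (delta_mx 0 i : 'rV[C]_3)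
         (fun s : 'rV[C]_3 => F (q s) (p s)) 0) /\
    (connected U ->
       forall s t, U s -> U t -> F (q s) (p s) = F (q t) (p t)).

(* Main.v *)
(* By the chain rule, the derivative of K_j along a solution, in a direction c,
   is the sum over i of c_i times the Poisson bracket of K_j and K_i; these
   brackets vanish identically once alpha1 = - alpha0. A function on an open
   connected set all of whose directional derivatives vanish is constant: apply
   the mean value theorem to its real and imaginary parts on segments inside a
   ball, then use connectedness. *)

Require Import Defs.
From mathcomp Require Import all_boot all_order all_algebra.
From mathcomp Require Import all_classical all_reals all_analysis.
From mathcomp Require Import complex ring.

Set Implicit Arguments.
Unset Strict Implicit.
Unset Printing Implicit Defensive.

Import Order.TTheory GRing.Theory Num.Theory.
Import numFieldNormedType.Exports.

Local Open Scope classical_set_scope.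
Local Open Scope ring_scope.
Local Open Scope complex_scope.

Lemma is_derive_coord (C : numFieldType) n (x v : 'rV[C]_n) (m : 'I_n) :
  is_derive x v (fun y : 'rV[C]_n => y 0 m) (v 0 m).
Proof.
have cvgv : (fun h : C => h^-1 *: (((fun y : 'rV[C]_n => y 0 m) \o shift x)
    (h *: v) - x 0 m)) @ 0^' --> v 0 m.
  apply: cvg_near_cst; near=> h.
  rewrite /= !mxE addrK /GRing.scale /= mulKf //.
  by near: h; exact: nbhs_dnbhs_neq.
by apply: DeriveDef; [apply: cvgP cvgv|apply: cvg_lim cvgv].
Unshelve. all: by end_near. Qed.

Lemma normc_ge_Im (R : rcfType) (z : R[i]) : `|complex.Im z|%:C <= `|z|.
Proof.
case: z => a b; rewrite normc_def lecR /= -sqrtr_sqr ler_wsqrtr //.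
by rewrite lerDr sqr_ge0.
Qed.

(* The mean value theorem is applied to real functionals of [f] along real
   segments. The field [C] is kept abstract, with [iota] and [L] standing for
   the embedding of the reals and for [Re] or [Im], because its topology is
   not inferred for the bare type [R[i]]. *)
Section real_functional.
Variables (R : realType) (C : numFieldType) (iota : {rmorphism R -> C}).
Variable L : C -> R.
Hypotheses (iota_le : {mono iota : r s / r <= s})
  (iota_dense : forall d, 0 < d -> exists2 r, 0 < r & iota r <= d)
  (L_sub : forall z w, L (z - w) = L z - L w)
  (L_scale : forall r z, L (iota r * z) = r * L z)
  (L_le : forall z, iota `|L z| <= `|z|).

Lemma iota_norm r : `|iota r| = iota `|r|.
Proof.
have iota_ge0 s : 0 <= s -> 0 <= iota s by rewrite -iota_le rmorph0.
case: (leP 0 r) => r0; first by rewrite !ger0_norm ?iota_ge0.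
rewrite -[LHS]normrN -rmorphN ger0_norm ?iota_ge0 ?ltr0_norm //.
by rewrite oppr_ge0 ltW.
Qed.

(** By [L_sub] and [L_scale], the difference quotient of the real function at a real increment [h]
    is [L] applied to the quotient of [f] at the increment [iota h]; by [L_le] it tends to 0 along
    with the latter. *)
Lemma is_derive_real_line (V : normedModType C) (f : V -> C) (a v : V) (r : R) :
  is_derive (a + iota r *: v) v f 0 ->
  is_derive r 1 (fun x => L (f (a + iota x *: v))) 0.
Proof.
have iota_lt := leW_mono iota_le.
move=> [df f0].
have cvg0 : (fun h : R => h^-1 *: (((fun x => L (f (a + iota x *: v)))
    \o shift r) (h *: 1) - L (f (a + iota r *: v)))) @ 0^' --> (0 : R).
  apply/cvgrPdist_lt => e e0.
  have : (fun h => h^-1 *: ((f \o shift (a + iota r *: v)) (h *: v)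
      - f (a + iota r *: v))) @ 0^' --> (0 : C) by rewrite -[X in _ --> X]f0.
  move=> /cvgrPdist_lt /(_ (iota e)); rewrite -{1}(rmorph0 iota) iota_lt.
  move=> /(_ e0) /nbhs_ballP[d /= d0 Hd].
  (* The radius [d] is an element of [C]; a ball in [R] needs a real radius below it. *)
  have [d' d'0 d'd] := iota_dense d0.
  apply/nbhs_ballP; exists d' => //= h; rewrite /ball /= sub0r normrN => hd h0.
  have := Hd (iota h); rewrite /ball /= !sub0r !normrN.
  rewrite fmorph_eq0 iota_norm => /(_ _ h0) H.
  rewrite -iota_lt; apply: le_lt_trans (H _); last first.
    by apply: lt_le_trans d'd; rewrite iota_lt.
  apply: le_trans (L_le _); rewrite iota_le.
  have -> : h *: (1 : R^o) + r = r + h by rewrite /GRing.scale /= mulr1 addrC.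
  rewrite rmorphD scalerDl addrA [iota h *: v + _]addrC.
  by rewrite /GRing.scale /= -fmorphV L_scale L_sub.
by apply: DeriveDef; [apply: cvgP cvg0|apply: cvg_lim cvg0].
Qed.

Lemma derive0_segment (V : normedModType C) (f : V -> C) (a v : V) :
  (forall r : R, 0 <= r <= 1 -> is_derive (a + iota r *: v) v f 0) ->
  L (f (a + v)) = L (f a).
Proof.
move=> fv; pose phi x := L (f (a + iota x *: v)).
have dphi (r : R) : 0 <= r <= 1 -> is_derive r 1 phi 0.
  by move=> /fv; exact: is_derive_real_line.
have [||c _] := @MVT_segment R phi (fun=> 0) 0 1 ler01.
- by move=> x; rewrite in_itv /= => /andP[x0 x1]; apply: dphi; rewrite !ltW.
- apply: derivable_within_continuous => x; rewrite in_itv /= => x01.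
  by have [] := dphi _ x01.
- rewrite mul0r => /eqP; rewrite subr_eq0 => /eqP.
  by rewrite /phi rmorph1 rmorph0 scale1r scale0r addr0.
Qed.

(** Balls inside [U] make [L \o f] locally constant, so the level set through [s] is open and closed
    in [U], hence all of [U]. *)
Lemma connected_derive0_cst (V : normedModType C) (U : set V) (f : V -> C) :
  open U -> connected U -> (forall x v, U x -> is_derive x v f 0) ->
  forall s t, U s -> U t -> L (f s) = L (f t).
Proof.
move=> oU cU df s t Us Ut.
have loc x : U x -> \forall y \near x, U y /\ L (f y) = L (f x).
  move=> Ux; have /nbhs_normP[e /= e0 He] := open_nbhs_nbhs (conj oU Ux).
  apply/nbhs_normP; exists e => //= y xy; split; first exact: He.
  (* Convexity of the ball: for [r] between 0 and 1, [x + iota r *: (y - x)] is no farther from [x]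
     than [y] is. *)
  rewrite -[y](subrKC x); apply: derive0_segment => r /andP[r0 r1].
  apply/df/He; rewrite /= opprD addrA subrr sub0r normrN normrZ distrC.
  apply: le_lt_trans xy; rewrite ler_piMl // iota_norm ger0_norm //.
  by rewrite -(rmorph1 iota) iota_le.
(* Keeping [P] arbitrary covers both the level set and its complement in [U]; the latter gives
   closedness. *)
have openP (P : R -> Prop) : open (U `&` [set x | P (L (f x))]).
  rewrite openE => x [Ux Px]; rewrite /interior /=.
  by apply: filterS (loc x Ux) => y [Uy yx]; split; rewrite //= yx.
have : U `&` [set x | L (f x) = L (f s)] = U.
  apply: cU; first by exists s.
  - exists (U `&` [set x | L (f x) = L (f s)]).
      exact: (openP (eq^~ (L (f s)))).
    by rewrite setIA setIid.
  - exists (~` (U `&` [set x | L (f x) <> L (f s)])).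
      by apply: open_closedC; exact: (openP (fun z => z <> L (f s))).
    apply/seteqP; split => x /= [Ux xs]; split => //; first by case.
    by apply: contrapT => ?; apply: xs.
by move=> /seteqP[_ /(_ t Ut)] [_ /= ->].
Qed.

End real_functional.

Section hamiltonian_differentials.
Variables (C : numFieldType) (alpha0 alpha1 : C).

(** The differential of [K1] at [(q, p)] on the tangent vector with [q]-component [u] and
    [p]-component [w]; [dK2] and [dK3] follow the same pattern. *)
Definition dK1 (q p u w : 'rV[C]_2) : C :=
  let: q1 := q 0 0 in let: q2 := q 0 1 in
  let: p1 := p 0 0 in let: p2 := p 0 1 in
  (p1 ^+ 2 + 2 * q1) * u 0 0
  + (1 / 2 * q2 + p1 * p2) * u 0 1
  + (2 * q1 * p1 - alpha0 + q2 * p2) * w 0 0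
  + (p1 * q2 - 1 / 2 * p2) * w 0 1.

Definition dK2 (q p u w : 'rV[C]_2) : C :=
  let: q1 := q 0 0 in let: q2 := q 0 1 in
  let: p1 := p 0 0 in let: p2 := p 0 1 in
  (q2 ^+ 2 + p2 ^+ 2) * u 0 0
  + (2 * q2 * p2 ^+ 2 - 1 / 2 * q2 - 2 * alpha0 * p2 + 2 * q1 * q2 - p1 * p2
     + 2 * p1 ^+ 2 * q2) * u 0 1
  + (2 * p1 * q2 ^+ 2 - q2 * p2) * w 0 0
  + (2 * q2 ^+ 2 * p2 + 1 / 2 * p2 - 2 * alpha0 * q2 + 2 * q1 * p2
     - p1 * q2) * w 0 1.

Definition dK3 (q p u w : 'rV[C]_2) : C :=
  let: q1 := q 0 0 in let: q2 := q 0 1 in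
  let: p1 := p 0 0 in let: p2 := p 0 1 in
  (q1 * p1 ^+ 4 + 3 * q1 ^+ 2 * p1 ^+ 2 + 2 * q1 ^+ 3 - alpha0 * p1 ^+ 3
     + 2 * alpha1 * q1 * p1 + p1 ^+ 3 * q2 * p2 - 1 / 4 * p1 ^+ 2 * p2 ^+ 2
     + 2 * q1 * p1 * q2 * p2 + 1 / 4 * p1 ^+ 2 * q2 ^+ 2
     + 1 / 2 * q1 * q2 ^+ 2 - 1 / 2 * q1 * p2 ^+ 2) * u 0 0
  + (1 / 8 * q2 ^+ 3 - 1 / 8 * q2 * p2 ^+ 2 + q1 * p1 ^+ 3 * p2
     + p1 ^+ 2 * q2 * p2 ^+ 2 - 1 / 4 * p1 * p2 ^+ 3 + q1 ^+ 2 * p1 * p2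
     + 1 / 2 * q1 * p1 ^+ 2 * q2 + 3 / 4 * p1 * q2 ^+ 2 * p2
     - alpha0 * p1 ^+ 2 * p2 + 1 / 2 * alpha1 * p1 * q2
     + 1 / 2 * q1 ^+ 2 * q2) * u 0 1
  + (2 * q1 ^+ 2 * p1 ^+ 3 + 2 * q1 ^+ 3 * p1 - 3 * alpha0 * q1 * p1 ^+ 2
     + alpha1 * q1 ^+ 2 + alpha0 ^+ 2 * p1 + 3 * q1 * p1 ^+ 2 * q2 * p2
     + p1 * q2 ^+ 2 * p2 ^+ 2 - 1 / 2 * q1 * p1 * p2 ^+ 2
     - 1 / 4 * q2 * p2 ^+ 3 + q1 ^+ 2 * q2 * p2 + 1 / 2 * q1 * p1 * q2 ^+ 2
     + 1 / 4 * q2 ^+ 3 * p2 - 2 * alpha0 * p1 * q2 * p2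
     + 1 / 4 * alpha0 * p2 ^+ 2 + 1 / 4 * alpha1 * q2 ^+ 2) * w 0 0
  + (1 / 8 * p2 ^+ 3 - 1 / 8 * q2 ^+ 2 * p2 + q1 * p1 ^+ 3 * q2
     + p1 ^+ 2 * q2 ^+ 2 * p2 - 1 / 2 * q1 * p1 ^+ 2 * p2
     - 3 / 4 * p1 * q2 * p2 ^+ 2 + q1 ^+ 2 * p1 * q2 + 1 / 4 * p1 * q2 ^+ 3
     - alpha0 * p1 ^+ 2 * q2 + 1 / 2 * alpha0 * p1 * p2
     - 1 / 2 * q1 ^+ 2 * p2) * w 0 1.

Definition dhamiltonian (j : 'I_3) :
    'rV[C]_2 -> 'rV[C]_2 -> 'rV[C]_2 -> 'rV[C]_2 -> C :=
  match val j with
  | 0%N => dK1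
  | 1%N => dK2
  | _ => dK3
  end.

(** The source [V] is arbitrary so that one chain rule gives both the partial derivatives, with [q]
    or [p] frozen, and the derivative along a solution, with [V] the space of times. *)
Lemma is_derive_hamiltonian (V : normedModType C) (x v : V)
    (q p : V -> 'rV[C]_2) (u w : 'rV[C]_2) (j : 'I_3) :
  (forall m, is_derive x v (fun s => q s 0 m) (u 0 m)) ->
  (forall m, is_derive x v (fun s => p s 0 m) (w 0 m)) ->
  is_derive x v (fun s => hamiltonian alpha0 alpha1 j (q s) (p s))
    (dhamiltonian j (q x) (p x) u w).
Proof.
move=> dq dp.
(* Once in the context, the four coordinate derivatives are found by instance search, which
   differentiates the polynomials; [field] then matches the result with the closed forms. *)
have q1' := dq 0; have q2' := dq 1; have p1' := dp 0; have p2' := dp 1.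
case: j => [[|[|[|//]]] lt_j]; rewrite /hamiltonian /dhamiltonian /=;
  apply: is_derive_eq; rewrite /GRing.scale /=.
- by rewrite /dK1; field; rewrite ?pnatr_eq0.
- by rewrite /dK2; field; rewrite ?pnatr_eq0.
- by rewrite /dK3; field; rewrite ?pnatr_eq0.
Qed.

Lemma partial_q_hamiltonian j m (q p : 'rV[C]_2) :
  partial_q (hamiltonian alpha0 alpha1 j) m q p
  = dhamiltonian j q p (delta_mx 0 m) 0.
Proof.
apply: derive_val; apply: is_derive_hamiltonian => k.
  exact: is_derive_coord.
by rewrite mxE; exact: is_derive_cst.
Qed.

Lemma partial_p_hamiltonian j m (q p : 'rV[C]_2) :
  partial_p (hamiltonian alpha0 alpha1 j) m q p
  = dhamiltonian j q p 0 (delta_mx 0 m).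
Proof.
apply: derive_val; apply: is_derive_hamiltonian => k.
  by rewrite mxE; exact: is_derive_cst.
exact: is_derive_coord.
Qed.

(* The coefficient of [c 0 i] is the Poisson bracket of [K_j] and [K_i]. *)
Lemma dhamiltonian_flow j (q p : 'rV[C]_2) (c : 'rV[C]_3) :
  alpha0 + alpha1 = 0 ->
  dhamiltonian j q p
    (\row_m \sum_(i < 3) partial_p (hamiltonian alpha0 alpha1 i) m q p * c 0 i)
    (\row_m - \sum_(i < 3) partial_q (hamiltonian alpha0 alpha1 i) m q p * c 0 i)
  = 0.
Proof.
move=> /eqP; rewrite addrC addr_eq0 => /eqP alpha1E.
(* The vectors [delta_mx 0 m] pick out the coefficients of the differentials, so each case becomes a
   polynomial identity in the coordinates, [alpha0] and the entries of [c]. *)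
case: j => [[|[|[|//]]] lt_j]; rewrite /dhamiltonian /= /dK1 /dK2 /dK3 !mxE;
  rewrite !big_ord_recl !big_ord0 !partial_p_hamiltonian !partial_q_hamiltonian;
  rewrite /dhamiltonian /= /dK1 /dK2 /dK3 !mxE /= alpha1E.
- by field; rewrite ?pnatr_eq0.
- by field; rewrite ?pnatr_eq0.
- by field; rewrite ?pnatr_eq0.
Qed.

End hamiltonian_differentials.

(** The direction [v] is arbitrary, not only a coordinate one, because constancy is later derived
    along segments of any direction. *)
Lemma is_derive_hamiltonian_solution (C : numFieldType) (alpha0 alpha1 : C)
    (U : set 'rV[C]_3) (q p : 'rV[C]_3 -> 'rV[C]_2) (j : 'I_3)
    (t v : 'rV[C]_3) :
  alpha0 + alpha1 = 0 ->
  is_solution (hamiltonian alpha0 alpha1) U q p -> U t ->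
  is_derive t v (fun s => hamiltonian alpha0 alpha1 j (q s) (p s)) 0.
Proof.
move=> halpha sol Ut; rewrite -(dhamiltonian_flow j (q t) (p t) v halpha).
have is_diff_derive (f df : 'rV[C]_3 -> C) :
    is_diff t f df -> is_derive t v f (df v).
  move=> [fd <-]; apply: DeriveDef; first exact: diff_derivable.
  exact: deriveE.
apply: is_derive_hamiltonian => m; rewrite mxE; have [dq dp] := sol t Ut m.
  exact: is_diff_derive dq.
exact: is_diff_derive dp.
Qed.

Theorem proposition4p2 (R : realType) (alpha0 alpha1 : R[i])
  (halpha : alpha0 + alpha1 = 0) :
  forall j : 'I_3,
    is_first_integral (hamiltonian alpha0 alpha1) (hamiltonian alpha0 alpha1 j).
Proof.
move=> j U q p oU sol; split=> [t Ut i|cU s t Us Ut].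
  exact: is_derive_hamiltonian_solution halpha sol Ut.
have iota_le : {mono (real_complex R) : r s / r <= s} := @lecR R.
(* A positive element of [R[i]] is real, so its real part embeds to [d] itself. *)
have iota_dense (d : R[i]) : 0 < d -> exists2 r : R, 0 < r & r%:C <= d.
  move=> d0; exists (complex.Re d); last by rewrite RRe_real // gtr0_real.
  by rewrite -ltcR RRe_real // gtr0_real.
have df x v : U x -> is_derive x v
    (fun s => hamiltonian alpha0 alpha1 j (q s) (p s)) 0.
  exact: is_derive_hamiltonian_solution halpha sol.
apply/eqP; rewrite eq_complex; apply/andP; split; apply/eqP.
- apply: (connected_derive0_cst iota_le iota_dense _ _ _ oU cU df Us Ut).
  + by move=> [? ?] [? ?].
  + by move=> r [b c] /=; rewrite mul0r subr0.
  + exact: normc_ge_Re.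
- apply: (connected_derive0_cst iota_le iota_dense _ _ _ oU cU df Us Ut).
  + by move=> [? ?] [? ?].
  + by move=> r [b c] /=; rewrite mul0r addr0.
  + exact: normc_ge_Im.
Qed.
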